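(* $\textsc{Empty-Child}$ reduces (by a black-box $\le_{dt}$ reduction) to $\textsc{Nephew-w-Inverse}$.
   Context: Query model with $\le_{dt}$ reductions (decision-tree reductions with log target-input-length plus depth $\mathrm{polylog}$ in the source size). $\textsc{Empty-Child}$: given $V=[N]$ and $F,L,R:V\to V$, a solution is (s1) $u$ with $F(L(u))\ne u$ or $F(R(u))\ne u$ or $L(u)=R(u)\ne u$, or (s2) $1$ if $L(1)=1$ or $R(1)=1$ or $F(1)\ne1$. $\textsc{Nephew-w-Inverse}$: given a finite set $V$, functions $f,g:V\to V$ and $f^{-1}:V\to V\cup\{\bot\}$, a solution is $u\in V$ with $f(f(g(u)))\ne f(u)$; or $u$ with $f(g(u))=u$; or $v$ with $f^{-1}(v)\ne\bot$ and $f(f^{-1}(v))\ne v$; or $v$ with $f^{-1}(v)=\bot$ and $f(f(v))\ne f(v)$. *)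

(* Defs.v *)
From mathcomp Require Import all_boot.

Set Implicit Arguments.
Unset Strict Implicit.
Unset Printing Implicit Defensive.

(** * Total search problems in the query model *)

(* An instance of size index [i] is an oracle answering every query [q] by an
   element of the finite alphabet [answer q]. *)
Record search_problem := SearchProblem {
  size_index : Type;
  query : size_index -> finType;
  answer : forall i, query i -> finType;
  solution : size_index -> finType;
  solves : forall i, (forall q : query i, answer q) -> solution i -> bool;
  total : forall i (x : forall q : query i, answer q), exists o, solves x o
}.

Definition input P (i : size_index P) := forall q : query i, answer q.

(* Number of bits needed to write down an element of [T]. *)
Definition bits (T : finType) : nat := up_log 2 #|T|.

Definition input_length P (i : size_index P) : nat :=
  \sum_(q : query i) bits (answer q).

(** * Decision trees *)

Inductive dtree P (i : size_index P) (T : Type) : Type :=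
| Leaf of T
| Ask (q : query i) of (answer q -> dtree i T).

Fixpoint run P (i : size_index P) T (x : input i) (t : dtree i T) : T :=
  match t with
  | Leaf r => r
  | Ask q k => run x (k (x q))
  end.

(* Depth over the Boolean encoding of the input: reading the whole answer to a
   query costs as many bit queries as there are bits in that answer. *)
Fixpoint depth P (i : size_index P) T (t : dtree i T) : nat :=
  match t with
  | Leaf _ => 0
  | Ask q k => bits (answer q) + \max_(a : answer q) depth (k a)
  end.

(** * Decision-tree reductions *)

Section Reduction.
Variables (P Q : search_problem) (i : size_index P) (j : size_index Q).

(* [inst q] computes the answer to [q] in the target instance, and [back o]
   turns a target solution [o] into a source solution. *)
Definition is_reduction (inst : forall q : query j, dtree i (answer q))
    (back : solution j -> dtree i (solution i)) : Prop :=
  forall (x : input i) (o : solution j),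
    solves (fun q => run x (inst q)) o -> solves x (run x (back o)).

Definition reduction_complexity (inst : forall q : query j, dtree i (answer q))
    (back : solution j -> dtree i (solution i)) : nat :=
  up_log 2 (input_length j) +
  maxn (\max_(q : query j) depth (inst q))
       (\max_(o : solution j) depth (back o)).

End Reduction.

(* The successor makes the bound meaningful on inputs of length at most 1. *)
Definition dt_reducible (P Q : search_problem) : Prop :=
  exists c : nat, forall i : size_index P, exists j : size_index Q,
  exists (inst : forall q : query j, dtree i (answer q))
         (back : solution j -> dtree i (solution i)),
    is_reduction inst back /\
    reduction_complexity inst back <= c * (up_log 2 (input_length i)).+1 ^ c.

(** * Empty-Child *)

(* The index [n] stands for [N = n.+1], and [ord0] for the vertex 1. *)
Section EmptyChild.
Variable n : nat.
Let V : finType := 'I_n.+1.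

Definition ec_query : finType := (V + V + V)%type.
Definition ec_F (u : V) : ec_query := inl (inl u).
Definition ec_L (u : V) : ec_query := inl (inr u).
Definition ec_R (u : V) : ec_query := inr u.
Definition ec_answer (q : ec_query) : finType := V.

Definition ec_solves (x : forall q : ec_query, ec_answer q) (u : V) : bool :=
  let F (v : V) : V := x (ec_F v) in
  let L (v : V) : V := x (ec_L v) in
  let R (v : V) : V := x (ec_R v) in
  [|| F (L u) != u, F (R u) != u, (L u == R u) && (R u != u)
    | (u == ord0) &&
        [|| L ord0 == ord0, R ord0 == ord0 | F ord0 != ord0]].

Lemma ec_total (x : forall q : ec_query, ec_answer q) :
  exists u, ec_solves x u.
Proof.
apply/existsP; apply: contraT; rewrite negb_exists => /forallP H.
pose F (v : V) : V := x (ec_F v).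
pose L (v : V) : V := x (ec_L v).
pose R (v : V) : V := x (ec_R v).
have FL : cancel L F.
  move=> u; apply/eqP; move: (H u); rewrite /ec_solves -/(L u) -/(F (L u)).
  by case: eqP.
have FR : cancel R F.
  move=> u; apply/eqP; move: (H u); rewrite /ec_solves -/(R u) -/(F (R u)).
  by case: (F (R u) == u); rewrite // orbT.
have LF : cancel F L by apply: canF_sym.
have LR u : L u = R u by rewrite -[RHS]LF FR.
move: (H ord0); rewrite /ec_solves -/(L ord0) -/(R ord0) -LR !eqxx /=.
by case: (L ord0 == ord0); rewrite /= !orbT.
Qed.

End EmptyChild.

Definition EmptyChild : search_problem := SearchProblem ec_total.

(** * Nephew-w-Inverse *)

Section Nephew.
Variable V : finType.

Definition nwi_query : finType := (V + V + V)%type.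
Definition nwi_f (u : V) : nwi_query := inl (inl u).
Definition nwi_g (u : V) : nwi_query := inl (inr u).
Definition nwi_finv (u : V) : nwi_query := inr u.
Definition nwi_answer (q : nwi_query) : finType :=
  match q with
  | inl _ => V
  | inr _ => option V
  end.

(* [None] stands for the undefined value of the partial inverse. *)
Definition nwi_solves (x : forall q : nwi_query, nwi_answer q) (u : V) : bool :=
  let f (v : V) : V := x (nwi_f v) in
  let g (v : V) : V := x (nwi_g v) in
  let finv (v : V) : option V := x (nwi_finv v) in
  [|| f (f (g u)) != f u,
      f (g u) == u
    | match finv u with
      | Some w => f w != u
      | None => f (f u) != f u
      end].

Lemma nwi_total (x : forall q : nwi_query, nwi_answer q) :
  0 < #|V| -> exists u, nwi_solves x u.
Proof.
move=> /card_gt0P[p0 _].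
apply/existsP; apply: contraT; rewrite negb_exists => /forallP H.
pose f (v : V) : V := x (nwi_f v).
pose g (v : V) : V := x (nwi_g v).
pose finv (v : V) : option V := x (nwi_finv v).
have Hs u : [/\ f (f (g u)) = f u, f (g u) <> u &
    match finv u with Some w => f w = u | None => f (f u) = f u end].
  move: (H u); rewrite /nwi_solves -/(g u) -/(f (g u)) -/(f (f (g u))) -/(f u).
  rewrite -/(finv u) !negb_or !negbK => /and3P[/eqP ? /eqP ?].
  by case: (finv u) => [w|] /negPn /eqP.
(* A vertex off the cycles of [f] has a fixed point as its parent. *)
have key v : ~~ fconnect f (f v) v -> f (f v) = f v.
  move=> vP; apply/eqP; apply: contraT => /eqP fv.
  pose D := [set y | fconnect f y v].
  have vD : v \in D by rewrite inE connect0.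
  have DS y : y \in D -> exists2 z, finv y = Some z & f z = y /\ z \in D.
    rewrite inE => yv; case: (Hs y) => _ _.
    case E: (finv y) => [z|] Hz.
      exists z => //; split=> //; rewrite inE.
      by apply: connect_trans yv; rewrite -Hz fconnect1.
    case/negP: vP; move: (iter_findex yv).
    case: (findex f y v) => [/= yE|k]; first by rewrite yE in Hz.
    have -> : iter k.+1 f y = f y.
      by elim: k => //= k ->.
    by move=> <-; rewrite Hz connect0.
  pose h y := odflt y (finv y).
  have hD y : y \in D -> f (h y) = y /\ h y \in D.
    by move=> /DS[z zE [fz zD]]; rewrite /h zE.
  have hinj : {in D &, injective h}.
    by move=> y z /hD[yE _] /hD[zE _] e; rewrite -yE -zE e.
  have /eqP hDD : h @: D == D.
    rewrite eqEcard card_in_imset // leqnn andbT.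
    by apply/subsetP => _ /imsetP[y /hD[_ ?] ->].
  move: vD; rewrite -{1}hDD => /imsetP[y yD vE].
  case/negP: vP; case: (hD y yD); rewrite -vE => -> _.
  by rewrite inE in yD.
have cycP v : fconnect f (f v) v -> exists k, iter k.+1 f v = v.
  by move=> /iter_findex e; exists (findex f (f v) v); rewrite iterSr.
have [p pP] : exists p, fconnect f (f p) p.
  have [|/key e] := boolP (fconnect f (f p0) p0); first by exists p0.
  by exists (f p0); rewrite e connect0.
case: (Hs p) => fw wp _; set w := f (g p) in fw wp.
have wP : ~~ fconnect f (f w) w.
  apply/negP => /cycP[k wk]; case/cycP: pP => j pj; apply: wp.
  have per m z a : iter m f z = z -> iter (a * m) f z = z.
    by move=> e; elim: a => //= a IH; rewrite mulSn iterD IH.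
  rewrite -(per _ _ j.+1 wk) -[RHS](per _ _ k.+1 pj) [in RHS]mulnC.
  by rewrite mulnS addSn !iterSr fw.
have gP : ~~ fconnect f (f (g p)) (g p).
  apply/negP => /cycP[k e]; case/negP: wP; rewrite -/w.
  have e2 : iter k f (f w) = w by rewrite -iterSr /w -iterSr iterS e.
  by rewrite -[X in fconnect f _ X]e2 fconnect_iter.
by case/negP: wP; rewrite -[X in fconnect f X _]/(f (f (g p))) key // connect0.
Qed.

End Nephew.

(* An empty [V] would give an instance without solutions. *)
Definition NephewWithInverse : search_problem :=
  @SearchProblem {V : finType | 0 < #|V|} _ _ _ _
    (fun V x => nwi_total x (svalP V)).

(* Main.v *)
(* Both problems live on the same vertex set.  The parent map is [F], except that
   a vertex whose parent [v] is isolated ([L v = R v = v]) is reattached to the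
   root; in particular isolated vertices become leaves below the root, where the
   inverse may be left undefined.  Away from violations, every parent now has two
   distinct children, so [u] has a sibling [w], and [L w] is a nephew of [u];
   on non-isolated vertices [L] inverts the parent map.  A violation at [u] can
   only be caused by an Empty-Child violation at the root, at [u], at the parent
   of [u] or at its sibling. *)

From mathcomp Require Import all_boot.
Require Import Defs.

Set Implicit Arguments.
Unset Strict Implicit.
Unset Printing Implicit Defensive.

Lemma sum_const (T : finType) k : \sum_(i : T) k = #|T| * k.
Proof. by rewrite -sum_nat_const; apply: eq_bigl. Qed.

(** * Sequential composition of decision trees *)

Section Bind.
Variables (P : search_problem) (i : size_index P).

Fixpoint bind T U (t : dtree i T) (k : T -> dtree i U) : dtree i U :=
  match t with
  | Leaf r => k r
  | Ask q h => Ask (fun a => bind (h a) k)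
  end.

Definition ask (q : query i) : dtree i (answer q) := Ask (fun a => Leaf i a).

Lemma depth_bind T U (t : dtree i T) (k : T -> dtree i U) d e :
  depth t <= d -> (forall a, depth (k a) <= e) -> depth (bind t k) <= d + e.
Proof.
move=> td ke; apply: leq_trans (leq_add td (leqnn e)).
elim: t {td} => [r|q h IH] /=; first exact: ke.
rewrite -addnA leq_add2l; apply/bigmax_leqP => a _.
by apply: leq_trans (IH a) _; rewrite leq_add2r (leq_bigmax a).
Qed.

Lemma depth_ask (q : query i) : depth (ask q) <= bits (answer q).
Proof. by rewrite /= big1 ?addn0. Qed.

End Bind.

(** * Query algorithms for the reduction *)

Section Reduction.
Variable n : nat.
Let V : finType := 'I_n.+1.
Local Notation tree := (@dtree EmptyChild n).

Definition askF (u : V) : tree V := @ask EmptyChild n (ec_F u).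
Definition askL (u : V) : tree V := @ask EmptyChild n (ec_L u).
Definition askR (u : V) : tree V := @ask EmptyChild n (ec_R u).

Definition isolated_tree (u : V) : tree bool :=
  bind (askL u) (fun l => bind (askR u) (fun r =>
  Leaf _ ((l == u) && (r == u)))).

Definition parent_tree (u : V) : tree V :=
  bind (askF u) (fun v => bind (isolated_tree v) (fun b =>
  Leaf _ (if b then ord0 else v))).

Definition sibling_tree (u : V) : tree V :=
  bind (parent_tree u) (fun p => bind (askL p) (fun l => bind (askR p) (fun r =>
  Leaf _ (if l == u then r else l)))).

Definition nephew_tree (u : V) : tree V := bind (sibling_tree u) askL.

Definition child_tree (u : V) : tree (option V) :=
  bind (isolated_tree u) (fun b => bind (askL u) (fun l =>
  Leaf _ (if b then None else Some l))).

Definition ec_solves_tree (u : V) : tree bool :=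
  bind (askL u) (fun l => bind (askR u) (fun r =>
  bind (askF l) (fun fl => bind (askF r) (fun fr =>
  bind (askL ord0) (fun l0 => bind (askR ord0) (fun r0 =>
  bind (askF ord0) (fun f0 =>
  Leaf _ [|| fl != u, fr != u, (l == r) && (r != u)
           | (u == ord0) && [|| l0 == ord0, r0 == ord0 | f0 != ord0]]))))))).

(** The default [ord0] on an exhausted list is harmless: correctness is claimed only for lists that
    contain a solution. *)
Fixpoint first_solution_tree (s : seq V) : tree V :=
  match s with
  | [::] => Leaf _ ord0
  | u :: s => bind (ec_solves_tree u) (fun b =>
                if b then Leaf _ u else first_solution_tree s)
  end.

Definition nwi_inst (q : nwi_query V) : tree (nwi_answer q) :=
  match q with
  | inl (inl u) => parent_tree u
  | inl (inr u) => nephew_tree u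
  | inr u => child_tree u
  end.

Definition ec_back (u : V) : tree V :=
  bind (parent_tree u) (fun p => bind (sibling_tree u) (fun w =>
  first_solution_tree [:: ord0; u; p; w])).

(** * Tracing violations back to Empty-Child *)

Section Correctness.
Variable x : @input EmptyChild n.
Let F (v : V) : V := x (ec_F v).
Let L (v : V) : V := x (ec_L v).
Let R (v : V) : V := x (ec_R v).

Let isolated v := (L v == v) && (R v == v).
Let parent v := if isolated (F v) then ord0 else F v.
Let sibling v := if L (parent v) == v then R (parent v) else L (parent v).

Lemma run_first_solution_tree (s : seq V) :
  has (ec_solves x) s -> ec_solves x (run x (first_solution_tree s)).
Proof.
elim: s => // u s IH us.
(* The leaf of [ec_solves_tree] repeats the body of [ec_solves], so this is a conversion. *)
rewrite -[run x _]/(run x (if ec_solves x u then _ else first_solution_tree s)).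
by case: ifPn us => //= /negPf->.
Qed.

Lemma ec_solvesPn (u : V) : ~~ ec_solves x u ->
  [/\ F (L u) = u, F (R u) = u & L u = R u -> isolated u].
Proof.
rewrite /ec_solves -/(F _) -/(F _) -/(L _) -/(R _) !negb_or !negbK.
case/and4P=> /eqP FL /eqP FR LR _; split=> // E.
by move: LR; rewrite /isolated E eqxx /= negbK => ->.
Qed.

Lemma ec_solves_rootPn : ~~ ec_solves x ord0 -> F ord0 = ord0 /\ ~~ isolated ord0.
Proof.
rewrite /ec_solves eqxx /= !negb_or !negbK => /and4P[_ _ _] /and3P[L0 _ /eqP ?].
by split=> //; rewrite /isolated negb_and L0.
Qed.

Lemma nwi_solvesE (u : V) :
  @nwi_solves V (fun q => run x (nwi_inst q)) u =
  [|| parent (parent (L (sibling u))) != parent u,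
      parent (L (sibling u)) == u
    | match (if isolated u then None else Some (L u)) with
      | Some w => parent w != u
      | None => parent (parent u) != parent u
      end].
Proof. by []. Qed.

(** By contraposition: if none of the four candidates violates Empty-Child, then [parent u] and
    [sibling u] are both non-isolated, so [parent] agrees with [F] on the sibling and on its left
    child. *)
Lemma nwi_solves_ec (u : V) :
  @nwi_solves V (fun q => run x (nwi_inst q)) u ->
  has (ec_solves x) [:: ord0; u; parent u; sibling u].
Proof.
apply: contraLR; rewrite -all_predC.
case/and5P=> /ec_solves_rootPn[F0 N0] /ec_solvesPn[FLu FRu _].
move=> /ec_solvesPn[FLp FRp LRp] /ec_solvesPn[FLw FRw _] _.
(* Either the root, non-isolated by [N0], or an [F u] that passed the test in [parent]. *)
have Np : ~~ isolated (parent u) by rewrite /parent; case: ifP => // ->.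
have parentE v y : F v = y -> ~~ isolated y -> parent v = y.
  by rewrite /parent => -> /negPf->.
have isolatedF v : F (L v) = v -> isolated v -> F v = v.
  by move=> FLv /andP[/eqP Lv _]; rewrite -[in LHS]Lv.
have Fw : F (sibling u) = parent u by rewrite /sibling; case: ifP.
have wu : sibling u != u.
  rewrite /sibling; case: ifP => [/eqP Lu|->//].
  by apply: contra Np => /eqP Ru; apply: LRp; rewrite Lu Ru.
(* An isolated sibling would be fixed by [F], hence equal to [parent u]. *)
have Nw : ~~ isolated (sibling u).
  apply/negP => Iw; move: (isolatedF _ FLw Iw); rewrite Fw => E.
  by move: Np; rewrite E Iw.
rewrite nwi_solvesE (parentE _ _ FLw Nw) (parentE _ _ Fw Np) eqxx (negPf wu) /=.
(* Only the inverse clause is left: an isolated [u] hangs below the root, a fixed point of [parent];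
   otherwise [L u] is a genuine child of [u]. *)
case: ifP => [Iu|/negbT Nu]; last by rewrite (parentE _ _ FLu Nu) eqxx.
have -> : parent u = ord0 by rewrite /parent (isolatedF _ FLu Iu) Iu.
by rewrite (parentE _ _ F0 N0) eqxx.
Qed.

Lemma nwi_inst_back_correct (u : V) :
  @nwi_solves V (fun q => run x (nwi_inst q)) u ->
  ec_solves x (run x (ec_back u)).
Proof.
by move=> /nwi_solves_ec /run_first_solution_tree.
Qed.

End Correctness.

(** * Depth of the trees *)

Let b := bits V.

(** Depth is measured in units of [b], the price of one query, so [m] counts queries. *)
Lemma depth_ask_bind T (q : ec_query n) (k : V -> tree T) m :
  (forall a, depth (k a) <= m * b) ->
  depth (bind (@ask EmptyChild n q) k) <= m.+1 * b.
Proof. by move=> kd; rewrite mulSn; apply: depth_bind; first exact: depth_ask. Qed.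

Lemma depth_isolated_tree u : depth (isolated_tree u) <= 2 * b.
Proof. by do 2!apply: depth_ask_bind => ?. Qed.

Lemma depth_parent_tree u : depth (parent_tree u) <= 3 * b.
Proof.
apply: depth_ask_bind => v; rewrite -[2]addn0 mulnDl.
by apply: depth_bind => //; apply: depth_isolated_tree.
Qed.

Lemma depth_sibling_tree u : depth (sibling_tree u) <= 5 * b.
Proof.
rewrite -[5]/(3 + 2) mulnDl.
apply: depth_bind => [|p]; first exact: depth_parent_tree.
by do 2!apply: depth_ask_bind => ?.
Qed.

Lemma depth_nephew_tree u : depth (nephew_tree u) <= 6 * b.
Proof.
rewrite -[6]/(5 + 1) mulnDl mul1n.
by apply: depth_bind => [|w]; [exact: depth_sibling_tree | exact: depth_ask].
Qed.

Lemma depth_child_tree u : depth (child_tree u) <= 3 * b.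
Proof.
rewrite -[3]/(2 + 1) mulnDl.
apply: depth_bind => [|i]; first exact: depth_isolated_tree.
by apply: depth_ask_bind => ?.
Qed.

Lemma depth_ec_solves_tree u : depth (ec_solves_tree u) <= 7 * b.
Proof. by do 7!apply: depth_ask_bind => ?. Qed.

Lemma depth_first_solution_tree (s : seq V) :
  depth (first_solution_tree s) <= (7 * size s) * b.
Proof.
elim: s => // u s IH; rewrite mulnS mulnDl.
by apply: depth_bind => [|[]] //; apply: depth_ec_solves_tree.
Qed.

Lemma depth_ec_back u : depth (ec_back u) <= 36 * b.
Proof.
(* One run of [parent_tree], one of [sibling_tree], and seven queries for each of the four
   candidates. *)
rewrite -[36]/(3 + (5 + 7 * 4)) !(mulnDl _ _ b).
apply: depth_bind => [|p]; first exact: depth_parent_tree.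
apply: depth_bind => [|w]; first exact: depth_sibling_tree.
exact: depth_first_solution_tree.
Qed.

Lemma depth_nwi_inst q : depth (nwi_inst q) <= 36 * b.
Proof.
case: q => [[u|u]|u].
- by apply: leq_trans (depth_parent_tree u) _; rewrite leq_mul2r orbT.
- by apply: leq_trans (depth_nephew_tree u) _; rewrite leq_mul2r orbT.
- by apply: leq_trans (depth_child_tree u) _; rewrite leq_mul2r orbT.
Qed.

Lemma ec_input_length : @input_length EmptyChild n = 3 * n.+1 * b.
Proof.
rewrite /input_length (eq_bigr (fun=> b)) // sum_const !card_sum card_ord.
by rewrite -[3]/(1 + 1 + 1) !mulnDl mul1n.
Qed.

End Reduction.

(** * Input lengths and the final bound *)

Lemma bits_option (T : finType) : 1 < #|T| -> bits (option T) <= (bits T).+1.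
Proof.
move=> T1; rewrite /bits card_option -up_logMp ?(ltnW T1) //.
by apply: leq_up_log; rewrite mul2n -addnn -addn1 leq_add2l ltnW.
Qed.

Lemma bits_gt0 (T : finType) : (0 < bits T) = (1 < #|T|).
Proof. by rewrite /bits up_log_gt0. Qed.

Lemma nwi_input_length (V : {V : finType | 0 < #|V|}) :
  @input_length NephewWithInverse V =
  2 * #|sval V| * bits (sval V) + #|sval V| * bits (option (sval V)).
Proof.
rewrite /input_length big_sumType big_sumType /nwi_answer /=.
by rewrite !sum_const -mulnA mul2n -addnn.
Qed.

Lemma card_ordS_gt0 n : 0 < #|('I_n.+1 : finType)|.
Proof. by rewrite card_ord. Qed.

Definition nwi_index n : size_index NephewWithInverse :=
  exist (fun V : finType => is_true (0 < #|V|)) _ (card_ordS_gt0 n).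

(** For [N >= 2] vertices of [b] bits each, an optional answer takes at most [2 * b] bits, so the
    target length is at most [4 * N * b], below twice the source length [3 * N * b]. *)
Lemma up_log2_nwi_input_length n :
  up_log 2 (input_length (nwi_index n)) <=
  (up_log 2 (@input_length EmptyChild n)).+1.
Proof.
rewrite nwi_input_length ec_input_length /= card_ord.
(* On one vertex the source length is 0 and the target length 1; both have [up_log] 0. *)
case: n => [|n]; first by rewrite /bits card_option !card_ord.
have b0 : 0 < bits 'I_n.+2 by rewrite bits_gt0 card_ord.
rewrite -up_logMp ?muln_gt0 //; apply: leq_up_log.
have := @bits_option 'I_n.+2; rewrite card_ord => /(_ isT) bo.
apply: leq_trans (_ : 2 * n.+2 * bits 'I_n.+2 + n.+2 * (2 * bits 'I_n.+2) <= _).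
  rewrite leq_add2l leq_mul2l; apply: leq_trans bo _.
  by rewrite mul2n -addnn -addn1 leq_add2l.
by rewrite mulnCA !mulnA -!mulnDl !leq_mul2r; apply/orP; right; apply/orP; right.
Qed.

Lemma bits_le_up_log2_input_length n :
  bits 'I_n.+1 <= up_log 2 (@input_length EmptyChild n).
Proof.
case: n => [|n]; first by rewrite /bits card_ord.
rewrite ec_input_length {1}/bits card_ord; apply: leq_up_log.
by rewrite mulnAC leq_pmull // muln_gt0 bits_gt0 card_ord.
Qed.

Theorem theorem5p12 : dt_reducible EmptyChild NephewWithInverse.
Proof.
(* 36 bounds the depths in units of [bits], and one more unit absorbs the log of the target
   length. *)
exists 37 => n.
exists (nwi_index n), (@nwi_inst n), (@ec_back n).
split=> [x o|]; first exact: nwi_inst_back_correct.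
set l := up_log 2 _.
have depth_le : 36 * bits 'I_n.+1 <= 36 * l.+1.
  by rewrite leq_mul2l (leq_trans (bits_le_up_log2_input_length n)).
(* A linear bound suffices, since [l.+1] is at least 1 and powers only increase it. *)
apply: leq_trans (_ : 37 * l.+1 <= _); last first.
  by rewrite leq_mul2l -{1}[l.+1]expn1 leq_pexp2l.
rewrite -[37]/(1 + 36) mulnDl mul1n; apply: leq_add.
  exact: up_log2_nwi_input_length.
rewrite geq_max; apply/andP; split; apply/bigmax_leqP => a _;
  apply: leq_trans depth_le.
- exact: depth_nwi_inst.
- exact: depth_ec_back.
Qed.
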